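(* Let $p$ be a prime, let $G$ be a finite group, let $B$ be a $p$-block of $G$ with defect group $D$, and let $x\in D$. Then $x$ is $B$-rational if and only if $x$ is rational in $G$.
   Context: $\mathrm{Irr}(B)$ is the set of irreducible ordinary (complex) characters in the block $B$. An element $x\in D$ is $B$-rational if $\chi(x)$ is a rational number for every $\chi\in\mathrm{Irr}(B)$. An element $x\in G$ is rational in $G$ if it is conjugate in $G$ to every generator of the cyclic group $\langle x\rangle$ (equivalently, $\chi(x)\in\mathbb{Q}$ for every irreducible complex character $\chi$ of $G$). *)

(* Defs.v *)
From mathcomp Require Import all_boot all_order all_algebra all_fingroup.
From mathcomp Require Import all_solvable all_field all_character.

Set Implicit Arguments.
Unset Strict Implicit.
Unset Printing Implicit Defensive.

Import Order.TTheory GRing.Theory Num.Theory.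
Local Open Scope ring_scope.

(* Blocks and defect groups are set up as in Navarro, Characters and Blocks   *)
(* of Finite Groups, Chapters 3 and 4, and Isaacs, Character Theory of        *)
(* Finite Groups, Chapter 15.  R is the ring Aint of algebraic integers, M a  *)
(* maximal ideal of R containing p, F = R / M the residue field               *)
(* (algebraically closed of characteristic p), S the localization of R at M,  *)
(* and red : S -> F the reduction modulo M S.  We never form F: the equation  *)
(* red a = red b is expressed by membership of a - b in M or in M S.          *)

Definition Aint_ideal (M : {pred algC}) : Prop :=
  [/\ {subset M <= Aint}, 0 \in M, {in M &, forall a b, a - b \in M}
    & {in Aint & M, forall a b, a * b \in M}].

Definition maximal_Aint_ideal (M : {pred algC}) : Prop :=
  [/\ Aint_ideal M, 1 \notin M
    & forall N : {pred algC}, Aint_ideal N -> {subset M <= N} -> 1 \notin N ->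
      {subset N <= M}].

(* The maximal ideal M S of the localization S, i.e., the kernel of red.      *)
Definition local_maximal_ideal (M : {pred algC}) (a : algC) : Prop :=
  exists r s : algC, [/\ r \in M, s \in Aint, s \notin M & a = r / s].

(* The central characters of F G afforded by 'chi_i and 'chi_j coincide.      *)
Definition eq_central_char (M : {pred algC}) (gT : finGroupType)
    (G : {group gT}) (i j : Iirr G) : Prop :=
  forall k : 'I_#|classes G|, 'omega_i['K_k] - 'omega_j['K_k] \in M.

(* A block is represented by the set of indices of its ordinary irreducible   *)
(* characters: a class of Irr(G) for equality of the reduced central          *)
(* characters.  A block is determined by this nonempty set.                   *)
Definition is_block (M : {pred algC}) (gT : finGroupType) (G : {group gT})
    (B : {set Iirr G}) : Prop :=
  exists i : Iirr G, forall j : Iirr G, j \in B <-> eq_central_char M i j.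

(* The coefficient at g of f_B = \sum_(chi in Irr(B)) e_chi, where            *)
(* e_chi = chi(1) / |G| \sum_g chi(g^-1) g.  By Osima's theorem it lies in S, *)
(* and the block idempotent of F G is e_B = red f_B.                           *)
Definition block_idem_coef (gT : finGroupType) (G : {group gT})
    (B : {set Iirr G}) (g : gT) : algC :=
  \sum_(i in B) 'chi_i 1%g * 'chi_i (g^-1)%g / #|G|%:R.

(* K is a defect class of B if lambda_B(K^+) != 0 and e_B has nonzero         *)
(* coefficient on K, where K^+ is the class sum and lambda_B the common       *)
(* central character of B.                                                    *)
Definition defect_class (M : {pred algC}) (gT : finGroupType) (G : {group gT})
    (B : {set Iirr G}) (k : 'I_#|classes G|) : Prop :=
  (forall i : Iirr G, i \in B -> 'omega_i['K_k] \notin M) /\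
  (forall z : gT, z \in enum_val k ->
     ~ local_maximal_ideal M (block_idem_coef B z)).

(* The defect groups of B are those of any defect class K of B, namely the    *)
(* Sylow p-subgroups of the centralizers of the elements of K.                *)
Definition is_defect_group (p : nat) (M : {pred algC}) (gT : finGroupType)
    (G : {group gT}) (B : {set Iirr G}) (D : {group gT}) : Prop :=
  exists (k : 'I_#|classes G|) (z : gT),
    [/\ defect_class M B k, z \in enum_val k & (p.-Sylow('C_G[z]) D)%g].

Definition B_rational (gT : finGroupType) (G : {group gT}) (B : {set Iirr G})
    (x : gT) : Prop :=
  forall i : Iirr G, i \in B -> 'chi_i x \in Crat.

Definition rational_in (gT : finGroupType) (G : {group gT}) (x : gT) : Prop :=
  forall y : gT, generator <[x]>%g y -> exists2 g : gT, g \in G & y = (x ^ g)%g.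

(* Main.v *)
(* A rational element takes rational values on all characters.  Conversely,   *)
(* let chi(x) be rational for all chi in B and let y generate <x>, so that    *)
(* chi(y) = chi(x) on B.  The pair t = (x, y) acts on G by g |-> x g y^-1 and *)
(* commutes with f_B = \sum_g a(g) g, whose coefficients lie in S, and the    *)
(* trace of t on K G f_B is \sum_(chi in B) chi(x) chi(y^-1).  As chi is      *)
(* rational on x, this trace is m_1 - m_zeta, the difference of the dimensions *)
(* of the eigenspaces of t for 1 and for a primitive p-th root of unity zeta. *)
(* Both are ranks of idempotent matrices over S, indexed by <t>-orbits, which *)
(* can be computed after reduction modulo M, where zeta becomes 1.  There the *)
(* two matrices only differ by the block of the fixed points of t on G, so    *)
(* that m_1 = m_zeta if x and y are not conjugate, while m_1 > m_zeta for     *)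
(* y = x, because the block contains a(z) for a z in C_G(x) in a defect class. *)
(* Hence \sum chi(x) chi(x^-1) is nonzero and \sum chi(x) chi(y^-1) is 0 when *)
(* x and y are not conjugate, against chi(y) = chi(x).                        *)

From HB Require Import structures.
Require Import Defs.
From mathcomp Require Import all_boot all_order all_algebra all_fingroup.
From mathcomp Require Import all_solvable all_field all_character.
From mathcomp Require boolp.
From mathcomp Require Import ring.

Set Implicit Arguments.
Unset Strict Implicit.
Unset Printing Implicit Defensive.

Import Order.TTheory GRing.Theory Num.Theory.
Local Open Scope ring_scope.


(** * Reduction modulo M *)

(** If [x] is rational, each [chi] takes the same value at [x] and at [x ^+ k] for [k] prime to the
    order of [x], so [chi x] equals all its Galois conjugates ([char_Crat_of_expg]).

    The converse is a block form of column orthogonality. Let [y] generate [<[x]>] and let [t] be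
    [g |-> x g y^-1], whose fixed points are the [g] with [x ^ g = y]. Rationality makes the trace
    of [t ^+ k] on the block algebra the same for all [k] prime to [p], so it is the difference of
    the multiplicities of two eigenvalues, 1 and a primitive [p]-th root of unity ([trace_diff]).
    Each multiplicity is the rank of an idempotent matrix with entries integral at [M]
    ([block_idem_coef_integral]), and such a rank survives reduction ([rank_idem_reduction]). Modulo
    [M] the root of unity becomes 1 and sums constant along a nontrivial orbit vanish, so the two
    matrices differ only at fixed points ([red_orbit_mx]).

    Without fixed points the trace is 0 ([block_orthogonality]). For [y = x] the fixed points 1 and
    [z], with [z] in a defect class and centralized by [x], make it nonzero
    ([block_fixed_nonvanishing]). Since [chi y = chi x] on [B], the two sums agree, which forces
    conjugacy. *)

Record algint := Algint { algint_val :> algC; algint_valP : algint_val \in Aint }.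
HB.instance Definition _ := [isSub for algint_val].
HB.instance Definition _ := [Choice of algint by <:].
HB.instance Definition _ := [SubChoice_isSubComNzRing of algint by <:].

Section ResidueField.

Variables (M : {pred algC}) (maxM : maximal_Aint_ideal M).

Definition algint_ideal : {pred algint} := [pred u | val u \in M].

Lemma algint_ideal_closed : idealr_closed algint_ideal.
Proof.
move: maxM => [[sMA M0 MB MM] M1 _].
split=> [||a u v]; rewrite !inE //= => Mu Mv.
have MN w : w \in M -> - w \in M by move=> Mw; rewrite -sub0r MB.
by rewrite -[X in _ + X]opprK MB ?MN // MM ?algint_valP.
Qed.

(** Maximality: the ideal [N] of elements congruent to a multiple of [a] contains both [M] and [a],
    hence 1. *)
Lemma algint_ideal_inv (a : algint) :
  a \notin algint_ideal -> exists r : algint, r * a - 1 \in algint_ideal.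
Proof.
move: maxM => [[sMA M0 MB MM] M1 Mmax] notMa.
pose N : {pred algC} := [pred u | boolp.asbool
  (u \in Aint /\ exists r : algint, u - val r * val a \in M)].
have MN u : u \in M -> - u \in M by move=> Mu; rewrite -sub0r MB.
have /negbNE/boolp.asboolP[_ [r Mr]] : ~~ (1 \notin N).
  apply: contra notMa => N1; apply: (Mmax N) => //.
  - split=> [u /boolp.asboolP[]//||u v /boolp.asboolP[Au [r Mr]]
             /boolp.asboolP[Av [s Ms]] | u v Au /boolp.asboolP[Av [s Ms]]].
    + by apply/boolp.asboolP; split; [rewrite rpred0 | exists 0; rewrite mul0r subr0].
    + apply/boolp.asboolP; split; first exact: rpredB.
      by exists (r - s); rewrite mulrBl opprD addrACA -opprD MB.
    + apply/boolp.asboolP; split; first exact: rpredM.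
      by exists (Algint Au * s); rewrite /= -mulrA -mulrBr MM.
  - move=> u Mu; apply/boolp.asboolP; split; first exact: sMA.
    by exists 0; rewrite mul0r subr0.
  - apply/boolp.asboolP; split; first exact: algint_valP.
    by exists 1; rewrite mul1r subrr.
by exists r; rewrite inE /= -opprB MN.
Qed.

Lemma residue_field : exists (F : fieldType) (red : {rmorphism algint -> F}),
  forall u, (red u == 0) = (val u \in M).
Proof.
pose zcI := GRing.isZmodClosed.Build _ algint_ideal (idealr_closedB algint_ideal_closed).
pose piI := isProperIdeal.Build _ algint_ideal (idealr_closed_nontrivial algint_ideal_closed).
pose I : idealr algint := HB.pack algint_ideal zcI piI.
pose Q := {ideal_quot I}.
have pi0 (u : algint) : ((\pi_Q)%qT u == 0) = (val u \in M).
  by rewrite -(rmorph0 (\pi_Q)%qT) -Quotient.idealrBE subr0.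
have /boolp.choice[inv invP] (v : Q) : exists w, if v == 0 then w = 0 else w * v = 1.
  case: eqVneq => [_|]; first by exists 0.
  rewrite -[v]reprK pi0 => /algint_ideal_inv[r Mr]; exists ((\pi_Q)%qT r).
  by apply/eqP; rewrite -rmorphM -subr_eq0 -(rmorph1 (\pi_Q)%qT) -rmorphB pi0.
have mulVq (v : Q) : v != 0 -> inv v * v = 1 by have:= invP v; case: eqP.
have inv0 : inv 0 = 0 by have:= invP 0; rewrite eqxx.
pose fQ := GRing.ComNzRing_isField.Build Q mulVq inv0.
pose F : fieldType := HB.pack Q fQ.
by exists F, (\pi_Q)%qT.
Qed.

End ResidueField.

Lemma maximal_Aint_ideal_prime (M : {pred algC}) : maximal_Aint_ideal M ->
  {in Aint &, forall a b, a * b \in M -> (a \in M) || (b \in M)}.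
Proof.
case/residue_field=> F [red redP] a b Aa Ab.
by rewrite -(redP (Algint Aa * Algint Ab)) rmorphM mulf_eq0 !redP.
Qed.

(** * Ranks of idempotent matrices *)

(** In a full rank factorization [P = U V], idempotence forces [V U = 1], whose size is the rank. *)
Lemma mxtrace_idem (K : numFieldType) n (P : 'M[K]_n) :
  P *m P = P -> \tr P = (\rank P)%:R.
Proof.
move=> PP; rewrite -{1}(mulmx_base P) mxtrace_mulC.
have := mulmx_base P; have := row_base_free P; have := col_base_full P.
move: (row_base P) (col_base P); move: (\rank P) => r V U.
move=> /row_fullP[L LU] /row_freeP[S VS] UV.
suff -> : V *m U = 1%:M by rewrite mxtrace1.
have : L *m (P *m P) *m S = L *m P *m S by rewrite PP.
by rewrite -UV !mulmxA LU !mul1mx -!mulmxA VS mulmx1.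
Qed.

Lemma rank_idem_compl (K : numFieldType) n (P : 'M[K]_n) :
  P *m P = P -> (\rank P + \rank (1%:M - P)%R)%N = n.
Proof.
move=> PP; have QQ : (1%:M - P) *m (1%:M - P) = 1%:M - P.
  by rewrite mulmxBl mul1mx mulmxBr mulmx1 PP subrr subr0.
apply/eqP; rewrite -(eqr_nat K) natrD -(mxtrace_idem PP) -(mxtrace_idem QQ).
by rewrite raddfB /= mxtrace1 addrC subrK.
Qed.

(** The rows of [E *m X] lie in the row space of [X] and are killed by [1%:M - E]; apply
    rank-nullity to that map on the row space. *)
Lemma rank_triangular (F : fieldType) n (X E : 'M[F]_n) :
  E *m X *m (1%:M - E) = 0 ->
  (\rank (E *m X)%R + \rank (X *m (1%:M - E))%R <= \rank X)%N.
Proof.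
move=> tri; rewrite -(mxrank_mul_ker X (1%:M - E)) addnC leq_add2l.
by apply: mxrankS; rewrite sub_capmx submxMl; apply/sub_kermxP.
Qed.

Section Reduction.

Variables (R : comNzRingType) (K : numFieldType) (F : fieldType).
Variables (f : {rmorphism R -> K}) (g : {rmorphism R -> F}).
Hypothesis injf : injective f.

(** A minor that is nonzero in [F] comes from a nonzero minor in [R], which stays nonzero in [K]. *)
Lemma rank_map_mx_le m n (A : 'M[R]_(m, n)) :
  (\rank (map_mx g A) <= \rank (map_mx f A))%N.
Proof.
set A' := map_mx g A; pose h := maxrankfun A'.
have fullT : row_full (rowsub h A')^T.
  by rewrite /row_full mxrank_tr; apply: maxrowsub_free.
pose k := fullrankfun fullT; pose S := mxsub h k A.
have unitS : map_mx g S \in unitmx.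
  rewrite -unitmx_tr (_ : _^T = rowsub k (rowsub h A')^T) ?fullrowsub_unit //.
  by apply/matrixP=> i j; rewrite !mxE.
have unitfS : map_mx f S \in unitmx.
  rewrite unitmxE det_map_mx unitfE raddf_eq0 //.
  apply: contraTneq unitS => S0; by rewrite unitmxE det_map_mx S0 rmorph0 unitr0.
rewrite -(mxrank_unit unitfS).
have -> : map_mx f S = rowsub h (map_mx f A) *m colsub k 1%:M.
  by rewrite -mxsub_mul mulmx1 map_mxsub.
apply: leq_trans (mxrankM_maxl _ _) _.
by rewrite mxrankS // rowsubE submxMl.
Qed.

(** [A] and [c%:M - A] can only lose rank under [g], but their images add up to an invertible scalar
    matrix, so the ranks still total at least [n], the sum for [P] and [1%:M - P]. Hence neither
    loses any. *)
Lemma rank_idem_reduction n (P : 'M[K]_n) (A : 'M[R]_n) c :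
  P *m P = P -> g c != 0 -> map_mx f A = f c *: P ->
  \rank (map_mx g A) = \rank P.
Proof.
move=> PP gc0 fA; have fc0 : f c != 0.
  by rewrite raddf_eq0 //; apply: contraNneq gc0 => ->; rewrite rmorph0.
have le1 := rank_map_mx_le A; have le2 := rank_map_mx_le (c%:M - A).
rewrite fA (eqmx_scale _ fc0) in le1.
rewrite !map_mxB fA !map_scalar_mx /= -[(f c)%:M]scalemx1 -scalerBr in le2.
rewrite (eqmx_scale _ fc0) in le2.
have := mxrank_add (map_mx g A) ((g c)%:M - map_mx g A).
rewrite addrC subrK mxrank_unit; last first.
  by rewrite unitmxE det_scalar unitrX // unitfE.
rewrite -{1}(rank_idem_compl PP) => le3.
by apply/eqP; rewrite eqn_leq le1 /= -(leq_add2r (\rank (1%:M - P)%R))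
  (leq_trans le3) // leq_add2l.
Qed.

End Reduction.

(** * Orbit matrices and fixed points *)

Section OrbitMatrix.

Variables (T : finType) (t : T -> T).

(* The value at a of e applied to the sum of w ^+ i over t^i b, which is an  *)
(* eigenvector of t for w^-1 when w ^+ order t b = 1.                         *)
Definition orbit_entry (R : comNzRingType) (e : T -> T -> R) (w : R) (a b : T) : R :=
  \sum_(i < fingraph.order t b) w ^+ i * e a (iter i t b).

(* Rows and columns outside the set L of orbit representatives are set to 0. *)
Definition orbit_mx (R : comNzRingType) (L : pred T) (e : T -> T -> R) (w : R) :
    'M[R]_#|T| :=
  \matrix_(i, j) (orbit_entry e w (enum_val i) (enum_val j)
    *+ (L (enum_val i) && L (enum_val j))).

(** One representative for each orbit that carries an eigenvector of [t] for [w^-1]. *)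
Definition eigen_root (R : comNzRingType) (w : R) : pred T :=
  [pred a | froots t a && (w ^+ fingraph.order t a == 1)].

Lemma sum_enum_val (V : nmodType) (f : T -> V) :
  \sum_a f a = \sum_(k < #|T|) f (enum_val k).
Proof. by rewrite -(big_enum_val f); apply: eq_bigl. Qed.

Hypothesis injt : injective t.

Lemma sum_orbits (V : nmodType) (f : T -> V) :
  \sum_a f a = \sum_(r | froots t r) \sum_(i < fingraph.order t r) f (iter i t r).
Proof.
rewrite (partition_big (froot t) (froots t)) /= => [|a _]; last first.
  exact: (roots_root (fconnect_sym injt)).
apply: eq_bigr => r /eqP rr.
rewrite -(big_mkord xpredT (fun i => f (iter i t r))).
rewrite (eq_bigl (mem (fingraph.orbit t r))) => [|a]; last first.
  by rewrite -{1}rr (root_connect (fconnect_sym injt)) fconnect_sym // fconnect_orbit.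
rewrite -big_uniq ?orbit_uniq //= (big_nth r) size_orbit.
by apply: eq_big_nat => i /andP[_ lti]; rewrite /fingraph.orbit nth_traject.
Qed.

Lemma dvdn_order_iter k a : iter k t a = a -> (fingraph.order t a %| k)%N.
Proof.
set o := fingraph.order t a => ka.
have io m : iter (m * o) t a = a.
  by elim: m => // m IHm; rewrite mulSn iterD IHm iter_order.
rewrite {1}(divn_eq k o) addnC iterD io in ka.
have := findex_iter (ltn_pmod k (fingraph.order_gt0 t a)).
by rewrite ka findex0 => /esym/eqP.
Qed.

Variables (e : T -> T -> algC) (q : nat) (w : algC).
Hypothesis e_inv : forall a b, e (t a) (t b) = e a b.
Hypothesis e_idem : forall a c, \sum_b e a b * e b c = e a c.
Hypotheses (q_gt0 : (0 < q)%N) (tq : forall a, iter q t a = a) (wq : w ^+ q = 1).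

Local Notation ord := (fingraph.order t).
Local Notation u := (orbit_entry e w).

Lemma iter_e_inv i a b : e (iter i t a) (iter i t b) = e a b.
Proof. by elim: i => //= i IHi; rewrite e_inv. Qed.

Lemma orbit_entry_shift a b : w ^+ ord b = 1 -> u (t a) b = w * u a b.
Proof.
move=> wb; rewrite /orbit_entry mulr_sumr.
rewrite -(big_mkord xpredT (fun i => w ^+ i * e (t a) (iter i t b))).
rewrite -(big_mkord xpredT (fun i => w * (w ^+ i * e a (iter i t b)))).
rewrite -orderSpred big_nat_recl //= big_nat_recr //= addrC; congr (_ + _); last first.
  by apply: eq_bigr => i _; rewrite e_inv exprS mulrA.
rewrite mulrA -exprS orderSpred wb !expr0 !mul1r.
by rewrite -{1}(iter_order injt b) -orderSpred /= e_inv.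
Qed.

Lemma orbit_entry_iter i a b : w ^+ ord b = 1 -> u (iter i t a) b = w ^+ i * u a b.
Proof.
move=> wb; elim: i => [|i IHi]; first by rewrite mul1r.
by rewrite iterS orbit_entry_shift // IHi mulrA -exprS.
Qed.

(** The projection [e] commutes with [t]; this is its matrix on the [w^-1]-eigenspace, in the basis
    of weighted orbit sums. *)
Lemma orbit_mx_idem :
  orbit_mx (eigen_root w) e w *m orbit_mx (eigen_root w) e w
    = orbit_mx (eigen_root w) e w.
Proof.
apply/matrixP=> i j; rewrite !mxE; set a := enum_val i; set c := enum_val j.
have [La|notLa] := boolP (eigen_root w a); last first.
  by rewrite mulr0n big1 // => k _; rewrite !mxE (negPf notLa) mulr0n mul0r.
have [Lc|notLc] := boolP (eigen_root w c); last first.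
  by rewrite andbF mulr0n big1 // => k _; rewrite !mxE (negPf notLc) andbF mulr0n mulr0.
have wc : w ^+ ord c = 1 by case/andP: Lc => _ /eqP.
pose f b := (u a b * u b c) *+ eigen_root w b.
transitivity (\sum_b f b).
  rewrite sum_enum_val.
  apply: eq_bigr => k _; rewrite !mxE /f La Lc andbT /=.
  by case: (eigen_root w _); rewrite ?mulr1n ?mulr0n ?mul0r.
rewrite mulr1n -[RHS]/(u a c).
transitivity (\sum_b e a b * u b c); last first.
  under eq_bigr do rewrite mulr_sumr.
  rewrite exchange_big; apply: eq_bigr => k _ /=.
  by under eq_bigr do rewrite mulrCA; rewrite -mulr_sumr e_idem.
rewrite [RHS]sum_orbits [LHS](bigID (froots t)) /= [X in _ + X]big1 ?addr0 => [|b nrb]; last first.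
  by rewrite /f /eigen_root /= (negPf nrb) mulr0n.
apply: eq_bigr => b rb; rewrite /f /eigen_root /= rb /=.
have [wb|nwb] := eqVneq (w ^+ ord b) 1.
  rewrite mulr1n mulr_suml; apply: eq_bigr => k _.
  by rewrite orbit_entry_iter // mulrA [w ^+ k * _]mulrC.
rewrite mulr0n big1 // => k _.
(* Going once round this orbit multiplies [u b c] by a factor other than 1, so [u b c = 0]. *)
have /eqP := orbit_entry_iter (ord b) b wc.
rewrite iter_order // -subr_eq0 -{1}[u b c]mul1r -mulrBl mulf_eq0 subr_eq0 eq_sym.
by rewrite (negPf nwb) /= => /eqP ubc; rewrite orbit_entry_iter // ubc !mulr0.
Qed.

(** The right-hand side is the trace of [e] composed with the projector [q^-1 \sum_i w^i t^i] onto
    the eigenspace. *)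
Lemma orbit_mx_trace :
  \tr (orbit_mx (eigen_root w) e w)
    = q%:R^-1 * \sum_(i < q) w ^+ i * \sum_a e a (iter i t a).
Proof.
transitivity (\sum_a u a a *+ eigen_root w a).
  rewrite sum_enum_val.
  by apply: eq_bigr => k _; rewrite !mxE andbb.
have nzq : q%:R != 0 :> algC by rewrite pnatr_eq0 -lt0n.
apply: (mulfI nzq); rewrite mulVKf //.
under [in RHS]eq_bigr do rewrite mulr_sumr.
rewrite exchange_big /= [in RHS]sum_orbits mulr_sumr.
rewrite [LHS](bigID (froots t)) /= [X in _ + X]big1 ?addr0 => [|b nrb]; last first.
  by rewrite /eigen_root /= (negPf nrb) mulr0n mulr0.
apply: eq_bigr => r rr; rewrite /eigen_root /= rr /=.
transitivity ((ord r)%:R * \sum_(j < q) w ^+ j * e r (iter j t r)); last first.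
  rewrite mulr_natl -[X in _ *+ X]card_ord -sumr_const; apply: eq_bigr => i _.
  by apply: eq_bigr => j _; rewrite -iterD addnC iterD iter_e_inv.
have /dvdnP[s qE] := dvdn_order_iter (tq r).
(* The [q] exponents make [s] turns around the orbit, which gives a geometric series of ratio
   [w ^+ ord r]. *)
have -> : \sum_(j < q) w ^+ j * e r (iter j t r) = (\sum_(i < s) (w ^+ ord r) ^+ i) * u r r.
  rewrite qE; elim: s {qE} => [|s IHs]; first by rewrite mul0n !big_ord0 mul0r.
  rewrite mulSn addnC big_split_ord /= IHs big_ord_recr mulrDl; congr (_ + _).
  rewrite mulr_sumr; apply: eq_bigr => i _; rewrite exprD mulnC exprM -mulrA.
  congr (_ * (_ * e r _)); rewrite addnC iterD; congr (iter i t _).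
  by elim: s {IHs} => [|s IHs]; rewrite ?muln0 // mulnS iterD IHs iter_order.
have [wr|nwr] := eqVneq (w ^+ ord r) 1.
  under eq_bigr do rewrite wr expr1n.
  by rewrite mulr1n sumr_const card_ord mulrA -natrM mulnC -qE.
suff -> : \sum_(i < s) (w ^+ ord r) ^+ i = 0 by rewrite mulr0n !mul0r !mulr0.
apply/eqP; have /eqP := subrX1 (w ^+ ord r) s.
by rewrite -exprM mulnC -qE wq subrr eq_sym mulf_eq0 subr_eq0 (negPf nwr).
Qed.

End OrbitMatrix.

(** * Fixed points and the difference of two eigenvalue multiplicities *)

Section FixedPointTrace.

Variables (T : finType) (t : T -> T) (p n : nat).
Hypotheses (injt : injective t) (p_pr : prime p).
Local Notation q := (p ^ n.+1)%N.
Hypothesis tq : forall a, iter q t a = a.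

Variables (F : fieldType) (red : {rmorphism algint -> F}).
Hypothesis red_p : red p%:R = 0.

Variables (e : T -> T -> algC) (c : algint) (E : T -> T -> algint).
Hypothesis e_inv : forall a b, e (t a) (t b) = e a b.
Hypothesis e_idem : forall a d, \sum_b e a b * e b d = e a d.
Hypotheses (red_c : red c != 0) (valE : forall a b, val (E a b) = val c * e a b).

Local Notation tau i := (\sum_a e a (iter i t a)).
Hypothesis tau_p' : forall i, (i < q)%N -> ~~ (p %| i)%N -> tau i = tau 1.

Local Notation ord := (fingraph.order t).

Variables (z : algC) (z_prim : p.-primitive_root z).

Let q_gt0 : (0 < q)%N. Proof. by rewrite expn_gt0 prime_gt0. Qed.
Let zq : z ^+ q = 1. Proof. by rewrite expnS exprM (prim_expr_order z_prim) expr1n. Qed.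
Let z0 := Algint (Aint_prim_root z_prim).

Let E_inv a b : E (t a) (t b) = E a b.
Proof. by apply: val_inj; rewrite !valE e_inv. Qed.

(** In characteristic [p], Frobenius gives [(red z0 - 1)^p = red z0^p - 1 = 0]. *)
Lemma red_prim_root : red z0 = 1.
Proof.
have pF : p \in [pchar F] by apply/andP; split=> //; rewrite -(rmorph_nat red) red_p.
have red_zp : (red z0) ^+ p = 1.
  rewrite -rmorphXn (_ : z0 ^+ p = 1) ?rmorph1 //.
  by apply: val_inj; rewrite rmorphXn /= prim_expr_order.
apply/eqP; rewrite -subr_eq0; have := pFrobenius_autB_comm pF (commr1 (red z0)).
rewrite !pFrobenius_autE red_zp expr1n subrr => /eqP.
by rewrite expf_eq0 prime_gt0.
Qed.

Lemma order_fixed a : (ord a == 1%N) = (t a == a).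
Proof.
apply/eqP/eqP=> [o1|ta]; first by rewrite -{2}(iter_order injt a) o1.
apply/eqP; rewrite eqn_leq fingraph.order_gt0 andbT dvdn_leq //.
exact: (dvdn_order_iter injt (k := 1)).
Qed.

Lemma p_dvd_order a : (p %| ord a)%N = (t a != a).
Proof.
have /(dvdn_pfactor _ _ p_pr)[k _] := dvdn_order_iter injt (tq a).
rewrite -order_fixed => ->; case: k => [|k]; first by rewrite dvdn1 gtn_eqF ?prime_gt1.
by rewrite expnS dvdn_mulr // gtn_eqF // -expnS -(expn0 p) ltn_exp2l ?prime_gt1.
Qed.

Lemma eigen_root_prim a : eigen_root t z a = froots t a && (t a != a).
Proof. by rewrite /eigen_root /= -(prim_order_dvd z_prim) p_dvd_order. Qed.

Lemma eigen_root1 a : eigen_root t (1 : algC) a = froots t a.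
Proof. by rewrite /eigen_root /= expr1n eqxx andbT. Qed.

Let P1 := orbit_mx t (eigen_root t (1 : algC)) e 1.
Let Pz := orbit_mx t (eigen_root t z) e z.
Let A1 := orbit_mx t (eigen_root t (1 : algC)) E 1.
Let Az := orbit_mx t (eigen_root t z) E z0.
Let fixmx : 'M[F]_#|T| :=
  diag_mx (\row_i (t (enum_val i) == enum_val i)%:R).

Lemma map_orbit_mx L (w : algint) :
  map_mx val (orbit_mx t L E w) = val c *: orbit_mx t L e (val w).
Proof.
apply/matrixP=> i j; rewrite !mxE mulrnAr rmorphMn rmorph_sum mulr_sumr.
congr (_ *+ _); apply: eq_bigr => k _.
by rewrite rmorphM rmorphXn /= valE mulrCA.
Qed.

(** [Az] only involves nontrivial orbits, and there [z0] reduces to 1; what must be checked is that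
    [A1] has zero entries modulo [M] from a nontrivial orbit to a fixed point. *)
Lemma red_orbit_mx : map_mx red A1 *m (1%:M - fixmx) = map_mx red Az.
Proof.
rewrite mulmxBr mulmx1 mul_mx_diag; apply/matrixP=> i j; rewrite !mxE.
set a := enum_val i; set b := enum_val j.
rewrite !eigen_root1 !eigen_root_prim.
have [tb|ntb] /= := eqVneq (t b) b; first by rewrite mulr1 subrr !andbF rmorph0.
rewrite mulr0 subr0 andbT; case ra: (froots t a); last by rewrite !mulr0n.
case rb: (froots t b); last by rewrite !andbF !mulr0n.
have [ta|nta] := eqVneq (t a) a; rewrite ?mulr0n ?mulr1n /orbit_entry; last first.
  rewrite !rmorph_sum; apply: eq_bigr => k _.
  by rewrite !rmorphM !rmorphXn /= red_prim_root rmorph1.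
(* As [a] is fixed, [E a] is constant along the orbit of [b], whose length is divisible by [p]. *)
rewrite rmorph0 (eq_bigr (fun=> E a b)) => [|k _]; last first.
  rewrite expr1n mul1r; elim: (val k) => //= m <-.
  by rewrite -{1}ta E_inv.
have /dvdnP[m ->] : (p %| ord b)%N by rewrite p_dvd_order.
by rewrite sumr_const card_ord -mulr_natr natrM !rmorphM red_p !mulr0.
Qed.

Lemma fixmx_red_Az : fixmx *m map_mx red Az = 0.
Proof.
rewrite mul_diag_mx; apply/matrixP=> i j; rewrite !mxE eigen_root_prim.
by case: eqP => _; rewrite ?mul0r //= andbF /= mulr0n rmorph0 mulr0.
Qed.

Let idem1 : P1 *m P1 = P1.
Proof. exact: orbit_mx_idem. Qed.
Let idemz : Pz *m Pz = Pz.
Proof. exact: orbit_mx_idem. Qed.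

Let rank1 : \rank (map_mx red A1) = \rank P1.
Proof.
apply: (rank_idem_reduction (f := val) val_inj idem1 red_c).
by rewrite map_orbit_mx.
Qed.

Let rankz : \rank (map_mx red Az) = \rank Pz.
Proof.
apply: (rank_idem_reduction (f := val) val_inj idemz red_c).
by rewrite map_orbit_mx.
Qed.

(** Terms with [p] dividing [i] cancel since [z ^+ i = 1]; all others carry [tau 1], with total
    weight [\sum_i (1 - z ^+ i) = q]. *)
Lemma trace_diff : \tr P1 - \tr Pz = tau 1.
Proof.
rewrite /P1 /Pz (orbit_mx_trace injt e_inv q_gt0 tq (expr1n _ _)).
rewrite (orbit_mx_trace injt e_inv q_gt0 tq zq) -mulrBr -sumrB.
have -> : \sum_(i < q) (1 ^+ i * tau i - z ^+ i * tau i)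
        = \sum_(i < q) (1 - z ^+ i) * tau 1.
  apply: eq_bigr => i _; rewrite expr1n -mulrBl.
  have [pi|p'i] := boolP (p %| i)%N; last by rewrite tau_p'.
  by move: pi; rewrite (prim_order_dvd z_prim) => /eqP->; rewrite subrr !mul0r.
rewrite -mulr_suml sumrB sumr_const card_ord.
suff -> : \sum_(i < q) z ^+ i = 0.
  by rewrite subr0 mulKf // pnatr_eq0 -lt0n.
apply/eqP; have /eqP := subrX1 z q; rewrite zq subrr eq_sym mulf_eq0 subr_eq0.
by rewrite -[z]expr1 -(prim_order_dvd z_prim) dvdn1 gtn_eqF ?prime_gt1.
Qed.

Lemma fixfree_trace : (forall a, t a != a) -> tau 1 = 0.
Proof.
move=> free; rewrite -trace_diff !mxtrace_idem // -rank1 -rankz -red_orbit_mx.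
suff -> : fixmx = 0 by rewrite subr0 mulmx1 subrr.
by apply/matrixP=> i j; rewrite !mxE (negPf (free _)) mul0rn.
Qed.

(** By [rank_triangular], the rank of [A1] modulo [M] exceeds that of [Az] by at least the rank of
    its fixed-point rows, which contain the nonzero entry [red (E a b)]. *)
Lemma fixed_trace a b : t a = a -> t b = b -> red (E a b) != 0 -> tau 1 != 0.
Proof.
move=> ta tb Eab; rewrite -trace_diff !mxtrace_idem // -rank1 -rankz.
rewrite subr_eq0 eqr_nat gtn_eqF //.
have := @rank_triangular _ _ (map_mx red A1) fixmx.
rewrite -mulmxA red_orbit_mx => /(_ fixmx_red_Az); apply: leq_trans.
rewrite -[X in (X < _)%N]add0n ltn_add2r lt0n mxrank_eq0.
apply: contraNneq Eab => /matrixP/(_ (enum_rank a) (enum_rank b)).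
have rfix d : t d = d -> froots t d.
  move=> td; have: fconnect t d (froot t d) := connect_root _ _.
  rewrite fconnect_orbit /fingraph.orbit.
  have /eqP-> : ord d == 1%N by rewrite order_fixed td.
  by rewrite inE /roots => /eqP ->.
have ordb : ord b = 1%N by apply/eqP; rewrite order_fixed tb.
rewrite mul_diag_mx !mxE !enum_rankK ta eqxx mul1r !eigen_root1 !rfix //=.
by rewrite /orbit_entry ordb big_ord1 mul1r => ->.
Qed.

End FixedPointTrace.

(** * Character values *)

Section RationalValues.

Variables (gT : finGroupType) (G : {group gT}) (chi : 'CF(G)) (x : gT).
Hypotheses (Nchi : chi \is a character) (Gx : x \in G).

Lemma char_cycle_roots : exists2 r : seq algC,
  {in r, forall w, w ^+ #[x]%g = 1} & forall k, chi (x ^+ k)%g = \sum_(w <- r) w ^+ k.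
Proof.
have sxG : <[x]>%g \subset G by rewrite cycle_subG.
have [r def_r] := char_sum_irr (cfRes_char <[x]> Nchi).
have lin_r psi : psi \in irr <[x]> -> psi \is a linear_char.
  by case/irrP=> i ->; apply: irr_cyclic_lin (cycle_cyclic x).
exists [seq 'chi_i x | i <- r] => [_ /mapP[i _ ->] | k].
  by rewrite -lin_charX ?cycle_id ?lin_r ?mem_irr // expg_order lin_char1 ?lin_r ?mem_irr.
rewrite -(cfResE chi sxG) ?mem_cycle // def_r sum_cfunE big_map.
by apply: eq_bigr => i _; rewrite lin_charX ?cycle_id ?lin_r ?mem_irr.
Qed.

(** The field automorphism raising [#[x]]-th roots of unity to the power [k] sends [chi x] to
    [chi (x ^+ k)] and fixes rationals. *)
Lemma char_Crat_expg k : coprime k #[x]%g -> chi x \in Crat -> chi (x ^+ k)%g = chi x.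
Proof.
move=> /Qn_aut_exists[u u_root] Qx; rewrite -[RHS](aut_Crat u Qx).
have [r r_root def_chi] := char_cycle_roots.
rewrite -[x in RHS]expg1 !def_chi rmorph_sum.
by apply: eq_big_seq => w /r_root w1; rewrite expr1 u_root.
Qed.

(** Every Galois automorphism of the cyclotomic field raises [eps] to some power [k] prime to
    [#[x]], so it fixes [chi x]. *)
Lemma char_Crat_of_expg :
  (forall k, coprime k #[x]%g -> chi (x ^+ k)%g = chi x) -> chi x \in Crat.
Proof.
move=> chiX; have [r r_root def_chi] := char_cycle_roots.
have [Qn galQn [QnC gQnC [eps [pr_eps _] QnG]]] := group_num_field_exists <[x]>.
have [a Da] := QnG _ G _ Nchi x (dvdnn _).
have : a \in 1%VS.
  have/galois_fixedField <- := galQn.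
  apply/fixedFieldP; rewrite ?memvf // => nu _; apply: (fmorph_inj QnC).
  have [nuC ->] := gQnC nu; rewrite Da.
  have pr_e : #[x]%g.-primitive_root (QnC eps) by rewrite fmorph_primitive_root.
  have pr_ne : #[x]%g.-primitive_root (nuC (QnC eps)) by rewrite fmorph_primitive_root.
  have [k Dk] := prim_rootP pr_e (prim_expr_order pr_ne).
  rewrite Dk prim_root_exp_coprime // in pr_ne.
  rewrite -[RHS](chiX k pr_ne) -[x in LHS]expg1 !def_chi rmorph_sum.
  apply: eq_big_seq => w /r_root/(prim_rootP pr_e)[m ->].
  by rewrite expr1 rmorphXn /= Dk exprAC.
by case/vlineP=> q Dq; rewrite -Da Dq rmorphZ_num rmorph1 mulr1 Crat_rat.
Qed.

End RationalValues.

(** By Schur's lemma the sum of the conjugates of [y] acts as a scalar, which its trace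
    determines. *)
Lemma irr_sum_conj (gT : finGroupType) (G : {group gT}) (i : Iirr G) (x y : gT) :
  x \in G -> y \in G ->
  \sum_(g in G) 'chi_i (x * y ^ g)%g = #|G|%:R * 'chi_i x * 'chi_i y / 'chi_i 1%g.
Proof.
move=> Gx Gy; pose rG := 'Chi_i; pose S := \sum_(g in G) rG (y ^ g)%g.
have chiE z : z \in G -> 'chi_i z = \tr (rG z) by move=> Gz; rewrite -irrRepr cfunE Gz.
have [s Ds] : exists s : algC, S = s%:M.
  apply/is_scalar_mxP.
  have /groupC absG := socle_irr (socle_of_Iirr i).
  apply: (mx_abs_irr_cent_scalar absG).
  apply/centgmxP=> h Gh; rewrite mulmx_suml mulmx_sumr [RHS](reindex_acts 'R _ Gh) ?astabsR //=.
  apply: eq_bigr => g Gg; rewrite -!repr_mxM ?groupJ ?groupM //.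
  by rewrite conjgM conjgE !mulgA mulgV mul1g.
have trS : #|G|%:R * 'chi_i y = s * 'chi_i 1%g.
  have <- : \tr S = s * 'chi_i 1%g by rewrite Ds mxtrace_scalar -mulr_natr -irrRepr cfRepr1.
  rewrite raddf_sum.
  rewrite mulr_natl -sumr_const; apply: eq_bigr => g Gg.
  by rewrite /= -chiE ?groupJ // cfunJ.
transitivity (s * 'chi_i x).
  rewrite chiE // -mxtraceZ -mul_scalar_mx -Ds mxtrace_mulC mulmx_sumr raddf_sum.
  apply: eq_bigr => g Gg; have Gyg : (y ^ g)%g \in G by rewrite groupJ.
  by rewrite /= -repr_mxM // chiE // groupM.
by rewrite [X in X / _]mulrAC trS mulrAC mulfK ?irr1_neq0.
Qed.

(** * The block idempotent *)

Section BlockIdempotent.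

Variables (gT : finGroupType) (G : {group gT}) (B : {set Iirr G}).

Local Notation a := (block_idem_coef B).

Lemma block_idem_coefJ g x : x \in G -> a (g ^ x)%g = a g.
Proof. by move=> Gx; apply: eq_bigr => i _; rewrite -conjVg cfunJ. Qed.

(** This is the idempotence of [f_B], read on the matrix of multiplication by [f_B] on the group
    algebra. *)
Lemma block_idem_coef_conv g k : g \in G -> k \in G ->
  \sum_(h in G) a (g * h^-1)%g * a (h * k^-1)%g = a (g * k^-1)%g.
Proof.
move=> Gg Gk; pose d i := 'chi[G]_i 1%g / #|G|%:R.
transitivity (\sum_(i in B) \sum_(j in B) d i * d j *
    \sum_(h in G) 'chi_i (h * g^-1)%g * 'chi_j (k * h^-1)%g).
  under [RHS]eq_bigr do under eq_bigr do rewrite mulr_sumr.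
  rewrite (eq_bigr _ (fun i _ => exchange_big _ _ _ _ _ _)) exchange_big /=.
  apply: eq_bigr => h _; rewrite mulr_suml; apply: eq_bigr => i _.
  rewrite mulr_sumr; apply: eq_bigr => j _; rewrite !invMg !invgK /d.
  by field; rewrite neq0CG.
apply: eq_bigr => i Bi; rewrite (bigD1 i) //= [X in _ + X]big1 ?addr0 => [|j /andP[_ ne_ji]];
  rewrite (reindex_acts 'R _ Gk) ?astabsR //=.
  have := generalized_orthogonality_relation (k * g^-1)%g i i.
  rewrite eqxx mul1r => orth; rewrite /d.
  have nzG : #|G|%:R != 0 :> algC by rewrite neq0CG.
  under eq_bigr do rewrite invMg mulKVg -mulgA.
  rewrite -[X in _ * X](mulVKf nzG) orth invMg invgK.
  by rewrite [LHS]mulrACA; field; rewrite nzG irr1_neq0.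
have := generalized_orthogonality_relation (k * g^-1)%g i j.
rewrite eq_sym (negPf ne_ji) mul0r => /eqP.
rewrite mulf_eq0 invr_eq0 (negPf (neq0CG _)) => /eqP orth.
by under eq_bigr do rewrite invMg mulKVg -mulgA; rewrite orth mulr0.
Qed.

Lemma block_idem_coef_trace x y : x \in G -> y \in G ->
  \sum_(g in G) a (g * (x * g * y^-1)^-1)%g = \sum_(i in B) 'chi_i x * 'chi_i y^-1%g.
Proof.
move=> Gx Gy; rewrite /block_idem_coef exchange_big; apply: eq_bigr => i _ /=.
transitivity ('chi_i 1%g / #|G|%:R * \sum_(g in G) 'chi_i (x * y^-1 ^ g)%g).
  rewrite mulr_sumr (reindex_inj invg_inj); apply: eq_big => [g|g]; rewrite groupV // => Gg.
  by rewrite mulrAC !invMg !invgK conjgE !mulgA.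
rewrite irr_sum_conj ?groupV //.
by field; rewrite irr1_neq0 neq0CG.
Qed.

(* w is the central character value function of an element of Z(R G), R = Aint. *)
Definition Aint_span_omega (w : Iirr G -> algC) : Prop :=
  exists2 m : 'I_#|classes G| -> algC, forall k, m k \in Aint &
    forall i, w i = \sum_k m k * 'omega_i['K_k].

Lemma eq_Aint_span_omega w v : w =1 v -> Aint_span_omega w -> Aint_span_omega v.
Proof. by move=> eq_wv [m Am Dw]; exists m => // i; rewrite -eq_wv. Qed.

Lemma Aint_span_omegaB w v :
  Aint_span_omega w -> Aint_span_omega v -> Aint_span_omega (fun i => w i - v i).
Proof.
case=> m Am Dw [l Al Dv]; exists (fun k => m k - l k) => [k|i]; first by rewrite rpredB.
by rewrite Dw Dv -sumrB; apply: eq_bigr => k _; rewrite mulrBl.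
Qed.

Lemma Aint_span_omegaM w v :
  Aint_span_omega w -> Aint_span_omega v -> Aint_span_omega (fun i => w i * v i).
Proof.
case=> m Am Dw [l Al Dv].
exists (fun k => \sum_s \sum_t m s * l t * (gring_classM_coef s t k)%:R) => [k|i].
  by do 2!apply: rpred_sum => ? _; rewrite !rpredM ?rpred_nat.
rewrite Dw Dv mulr_suml.
under [RHS]eq_bigr do rewrite mulr_suml; rewrite [RHS]exchange_big /=.
apply: eq_bigr => s _; rewrite mulr_sumr.
under [RHS]eq_bigr do rewrite mulr_suml; rewrite [RHS]exchange_big /=.
apply: eq_bigr => t _; rewrite mulrACA -gring_irr_modeM ?gring_class_sum_central //.
rewrite gring_classM_expansion raddf_sum mulr_sumr; apply: eq_bigr => k _.
by rewrite /= xcfunZr mulrA.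
Qed.

Lemma Aint_span_omega_class k : Aint_span_omega (fun i => 'omega_i['K_k]).
Proof.
exists (fun l => (l == k)%:R) => [l|i]; first exact: rpred_nat.
by rewrite (bigD1 k) //= eqxx mul1r big1 ?addr0 // => l /negPf->; rewrite mul0r.
Qed.

Lemma Aint_span_omega_cst c : c \in Aint -> Aint_span_omega (fun=> c).
Proof.
move=> Ac; pose k1 := enum_rank_in (classes1 G) (1%g : {set gT}).
exists (fun k => c *+ (k == k1)) => [k|i]; first exact: rpredMn.
rewrite (bigD1 k1) //= eqxx big1 ?addr0 => [|k /negPf->]; last by rewrite mul0r.
have k1_1 : 1%g \in enum_val k1 by rewrite enum_rankK_in ?classes1 // set11.
by rewrite (gring_mode_class_sum_eq i k1_1) class1G cards1 mul1r divff ?irr1_neq0 ?mulr1.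
Qed.

Lemma Aint_span_omega_prod (I : finType) (P : pred I) (w : I -> Iirr G -> algC) :
  (forall j, P j -> Aint_span_omega (w j)) ->
  Aint_span_omega (fun i => \prod_(j | P j) w j i).
Proof.
move=> Aw; elim: (index_enum I) => [|j s IHs].
  by apply: eq_Aint_span_omega (Aint_span_omega_cst Aint1) => i; rewrite big_nil.
have [Pj|notPj] := boolP (P j).
  apply: eq_Aint_span_omega (Aint_span_omegaM (Aw j Pj) IHs) => i.
  by rewrite big_cons Pj.
by apply: eq_Aint_span_omega IHs => i; rewrite big_cons (negPf notPj).
Qed.

(** Second orthogonality recovers from [w] the coefficient at [g] of the central element
    [\sum_k m k K_k^+], namely the [m k] of the class of [g]. *)
Lemma Aint_span_omega_coef w g : Aint_span_omega w ->
  \sum_i w i * 'chi_i 1%g * 'chi_i g^-1%g / #|G|%:R \in Aint.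
Proof.
case=> m Am Dw; have [Gg|notGg] := boolP (g \in G); last first.
  by rewrite big1 ?rpred0 // => i _; rewrite ['chi_i g^-1%g]cfun0 ?groupV // mulr0 mul0r.
suff -> : \sum_i w i * 'chi_i 1%g * 'chi_i g^-1%g / #|G|%:R
        = \sum_k m k * (g \in enum_val k)%:R.
  by rewrite rpred_sum // => k _; rewrite rpredM ?rpred_nat.
under eq_bigr do rewrite Dw !mulr_suml; rewrite exchange_big; apply: eq_bigr => k _ /=.
have /repr_classesP[Gr Dk] := enum_valP k; move: (repr _) => r in Gr Dk.
have kr : r \in enum_val k by rewrite Dk class_refl.
transitivity (m k * (#|(r ^: G)%g|%:R / #|G|%:R * \sum_i 'chi[G]_i r * ('chi_i g)^*)).
  rewrite !mulr_sumr; apply: eq_bigr => i _.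
  by rewrite (gring_mode_class_sum_eq i kr) irr_inv; field; rewrite irr1_neq0 neq0CG.
rewrite second_orthogonality_relation // Dk class_sym; congr (_ * _).
case: (g \in _); rewrite ?mulr0n ?mulr0 // mulr1n mulrAC -natrM -index_cent1 mulnC.
by rewrite Lagrange ?subsetIl // divff ?neq0CG.
Qed.

End BlockIdempotent.

(** Osima's theorem with a common denominator: an element of the center of [R G] takes the value [c]
    on [B] and 0 elsewhere. *)
Lemma block_idem_coef_integral (M : {pred algC}) (gT : finGroupType)
    (G : {group gT}) (B : {set Iirr G}) :
  maximal_Aint_ideal M -> is_block M B ->
  exists c : algint, val c \notin M /\ forall g, val c * block_idem_coef B g \in Aint.
Proof.
move=> maxM [i0 defB]; have [[_ M0 MB _] M1 _] := maxM.
have /fin_all_exists[kk kkP] (j : Iirr G) : exists k : 'I_#|classes G|,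
    j \notin B -> 'omega_i0['K_k] - 'omega_j['K_k] \notin M.
  have [Bj|/negP notBj] := boolP (j \in B).
    by exists (enum_rank_in (classes1 G) (1%g : {set gT})).
  have /existsP[k notMk] : [exists k : 'I_#|classes G|,
      'omega_i0['K_k] - 'omega_j['K_k] \notin M].
    apply/existsPn => allM; apply: notBj; apply/defB => k.
    by have := allM k; rewrite negbK.
  by exists k.
(* The factor at [j] kills ['omega_j], while the class [kk j] separates [j] from [B] modulo [M]; so
   [b] vanishes off [B] and avoids [M] on [B]. *)
pose b i := \prod_(j | j \notin B) ('omega_i['K_(kk j)] - 'omega_j['K_(kk j)]).
have Aomega := Aint_gring_mode_class_sum.
have Ab i : b i \in Aint by apply: rpred_prod => j _; rewrite rpredB.
have prod_notM (P : pred (Iirr G)) (f : Iirr G -> algC) : (forall j, f j \in Aint) ->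
    (forall j, P j -> f j \notin M) -> \prod_(j | P j) f j \notin M.
  move=> Af notMf.
  suff /andP[] : (\prod_(j | P j) f j \in Aint) && (\prod_(j | P j) f j \notin M) by [].
  elim/big_rec: _ => [|j u Pj /andP[Au notMu]]; first by rewrite rpred1.
  rewrite rpredM //=; apply/negP => /(maximal_Aint_ideal_prime maxM (Af j) Au).
  by rewrite (negPf (notMf j Pj)) (negPf notMu).
have notMb i : i \in B -> b i \notin M.
  move=> /defB Bi; apply: prod_notM => j; first by rewrite rpredB.
  move=> /kkP; apply: contra => Mij.
  rewrite -[X in X - _](subrK 'omega_i['K_(kk j)]) -addrA.
  by rewrite -[X in _ + X]opprK MB // -sub0r MB.
pose c := \prod_(j in B) b j.
have Ac : c \in Aint by apply: rpred_prod.
exists (Algint Ac); split=> [|g]; first exact: prod_notM.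
(* c f_B = c - \prod_(j in B) (b j - z) for z in Z(R G) with omega_i(z) = b i *)
pose w i := c - \prod_(j in B) (b j - b i).
have wE i : w i = if i \in B then c else 0.
  rewrite /w; case: ifPn => [Bi|notBi].
    by rewrite [X in _ - X](bigD1 i) //= subrr mul0r subr0.
  have -> : b i = 0 by rewrite /b (bigD1 i) //= subrr mul0r.
  by under [X in _ - X]eq_bigr do rewrite subr0; rewrite subrr.
have -> : val (Algint Ac) * block_idem_coef B g
        = \sum_i w i * 'chi_i 1%g * 'chi_i g^-1%g / #|G|%:R.
  rewrite /block_idem_coef /= mulr_sumr big_mkcond; apply: eq_bigr => i _.
  by rewrite wE; case: ifP; rewrite ?mul0r // !mulrA.
have Wb : Aint_span_omega b.
  apply: Aint_span_omega_prod => j _; apply: Aint_span_omegaB.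
    exact: Aint_span_omega_class.
  exact: Aint_span_omega_cst.
apply: Aint_span_omega_coef; apply: Aint_span_omegaB; first exact: Aint_span_omega_cst.
apply: Aint_span_omega_prod => j _; apply: Aint_span_omegaB => //.
exact: Aint_span_omega_cst.
Qed.

(** * The action of a pair of [p]-elements on the block algebra *)

Section BlockTrace.

Variables (p n : nat) (M : {pred algC}) (gT : finGroupType) (G : {group gT}).
Variables (B : {set Iirr G}) (x y : gT).
Local Notation q := (p ^ n.+1)%N.
Hypotheses (p_pr : prime p) (maxM : maximal_Aint_ideal M) (Mp : p%:R \in M).
Hypothesis blockB : is_block M B.
Hypotheses (Gx : x \in G) (Gy : y \in G) (xq : (x ^+ q = 1)%g) (yq : (y ^+ q = 1)%g).
Hypothesis chiX : forall i k, i \in B -> ~~ (p %| k)%N ->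
  'chi_i (x ^+ k)%g = 'chi_i x /\ 'chi_i (y ^- k)%g = 'chi_i (y^-1)%g.

Let t (u : subg_of G) : subg_of G := subg G (x * sgval u * y^-1)%g.
(** The matrix of multiplication by [f_B] in the basis [G] of the group algebra. *)
Let e (u v : subg_of G) : algC := block_idem_coef B (sgval u * (sgval v)^-1)%g.

Let sgval_t u : sgval (t u) = (x * sgval u * y^-1)%g.
Proof. by rewrite subgK // !groupM ?groupV ?subgP. Qed.

Let sgval_iter k u : sgval (iter k t u) = (x ^+ k * sgval u * y ^- k)%g.
Proof.
elim: k => [|k IHk]; first by rewrite !expg0 invg1 mul1g mulg1.
by rewrite iterS sgval_t IHk !expgS invMg !mulgA.
Qed.

Let t_inj : injective t.
Proof.
by move=> u v /(congr1 sgval); rewrite !sgval_t => /mulIg/mulgI/subg_inj.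
Qed.

Let tq u : iter q t u = u.
Proof. by apply: subg_inj; rewrite sgval_iter xq yq invg1 mul1g mulg1. Qed.

Let e_inv u v : e (t u) (t v) = e u v.
Proof.
rewrite /e !sgval_t -[RHS](block_idem_coefJ _ _ (groupVr Gx)).
by rewrite conjgE invgK !invMg !invgK !mulgA mulgKV.
Qed.

Lemma sum_subg (f : gT -> algC) : \sum_(u : subg_of G) f (sgval u) = \sum_(g in G) f g.
Proof.
rewrite [RHS](reindex_onto sgval (subg G)) => [|g Gg]; last by rewrite subgK.
by apply: eq_bigl => u; rewrite subgP sgvalK eqxx.
Qed.

Let e_idem u v : \sum_w e u w * e w v = e u v.
Proof.
rewrite (sum_subg (fun h => block_idem_coef B (sgval u * h^-1)%g
  * block_idem_coef B (h * (sgval v)^-1)%g)).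
by rewrite block_idem_coef_conv ?subgP.
Qed.

Let tau k : \sum_u e u (iter k t u) = \sum_(i in B) 'chi_i (x ^+ k)%g * 'chi_i (y ^- k)%g.
Proof.
under eq_bigr do rewrite /e sgval_iter.
rewrite (sum_subg (fun g => block_idem_coef B (g * (x ^+ k * g * y ^- k)^-1)%g)).
by rewrite block_idem_coef_trace ?groupX.
Qed.

Let tau_p' k : (k < q)%N -> ~~ (p %| k)%N ->
  \sum_u e u (iter k t u) = \sum_u e u (iter 1 t u).
Proof.
move=> _ p'k; rewrite !tau; apply: eq_bigr => i Bi.
by have [-> ->] := chiX Bi p'k; rewrite !expg1.
Qed.

Let tau1 : \sum_u e u (iter 1 t u) = \sum_(i in B) 'chi_i x * 'chi_i (y^-1)%g.
Proof. by rewrite tau !expg1. Qed.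

(** A fixed point of [t] would conjugate [x] to [y], so [fixfree_trace] applies. *)
Lemma block_orthogonality : (forall g, g \in G -> y != (x ^ g)%g) ->
  \sum_(i in B) 'chi_i x * 'chi_i (y^-1)%g = 0.
Proof.
move=> not_xGy; rewrite -tau1.
have [F [red redP]] := residue_field maxM.
have [c [notMc Aca]] := block_idem_coef_integral maxM blockB.
have [z z_prim] := C_prim_root_exists (prime_gt0 p_pr).
pose E (u v : subg_of G) := Algint (Aca (sgval u * (sgval v)^-1)%g).
apply: (fixfree_trace t_inj p_pr tq (red := red) _ e_inv e_idem (c := c) (E := E)
          _ _ tau_p' z_prim) => [||//|u].
- by apply/eqP; rewrite redP rmorph_nat.
- by rewrite redP.
apply: contra (not_xGy _ (subgP u)) => /eqP/(congr1 sgval).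
rewrite sgval_t => xuy; have xu : (x * sgval u = sgval u * y)%g by rewrite -{2}xuy mulgKV.
by rewrite conjgE xu mulKg.
Qed.

Lemma block_fixed_nonvanishing (u v : gT) :
    u \in G -> v \in G -> (x * u = u * y)%g -> (x * v = v * y)%g ->
    ~ local_maximal_ideal M (block_idem_coef B (u * v^-1)%g) ->
  \sum_(i in B) 'chi_i x * 'chi_i (y^-1)%g != 0.
Proof.
move=> Gu Gv fixu fixv nzuv; rewrite -tau1.
have [F [red redP]] := residue_field maxM.
have [c [notMc Aca]] := block_idem_coef_integral maxM blockB.
have [z z_prim] := C_prim_root_exists (prime_gt0 p_pr).
pose E (u v : subg_of G) := Algint (Aca (sgval u * (sgval v)^-1)%g).
have fix_t g : g \in G -> (x * g = g * y)%g -> t (subg G g) = subg G g.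
  by move=> Gg fixg; apply: subg_inj; rewrite sgval_t subgK // fixg mulgK.
apply: (fixed_trace t_inj p_pr tq (red := red) _ e_inv e_idem (c := c) (E := E)
          _ _ tau_p' z_prim (fix_t u Gu fixu) (fix_t v Gv fixv)) => [||//|].
- by apply/eqP; rewrite redP rmorph_nat.
- by rewrite redP.
(* Were [c] times the coefficient in [M], dividing by [c], which is outside [M], would put the
   coefficient in the local maximal ideal. *)
rewrite redP /= !subgK //; apply/negP => Mca; apply: nzuv.
exists (val c * block_idem_coef B (u * v^-1)%g), (val c); split=> //.
  exact: algint_valP.
rewrite mulrC mulKf //; apply: contraNneq notMc => ->.
by case: maxM => [[]].
Qed.

End BlockTrace.

Theorem corollary27 (p : nat) (M : {pred algC}) (gT : finGroupType)
    (G : {group gT}) (B : {set Iirr G}) (D : {group gT}) (x : gT) :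
  prime p ->
  maximal_Aint_ideal M -> p%:R \in M ->
  is_block M B ->
  is_defect_group p M B D ->
  x \in D ->
  B_rational B x <-> rational_in G x.
Proof.
move=> p_pr maxM Mp blockB [k [z [[_ nz_z] kz sylD]]] Dx.
have /setIP[Gx cxz] := subsetP (pHall_sub sylD) x Dx.
have Gz : z \in G.
  have /imsetP[g Gg Dk] := enum_valP k.
  by move: kz; rewrite Dk; apply: subsetP; rewrite class_subG.
have p_x : (p.-elt x)%g := mem_p_elt (pHall_pgroup sylD) Dx.
split=> [Qx y gen_y | rat_x i _]; last first.
  apply: char_Crat_of_expg => // [|j co_j]; first exact: irr_char.
  have /rat_x[g Gg ->] : generator <[x]>%g (x ^+ j)%g by rewrite generator_coprime coprime_sym.
  by rewrite cfunJ.
have [j def_y] : exists j, y = (x ^+ j)%g by apply/cycleP/cycle_generator.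
have co_j : coprime j #[x]%g by move: gen_y; rewrite def_y generator_coprime coprime_sym.
(* The trivial element is set apart because the trace argument needs a positive power of [p] as
   exponent. *)
have [x1|ntx] := eqVneq x 1%g; first by exists 1%g; rewrite ?group1 // def_y x1 expg1n conj1g.
have [n ox] : exists n, #[x]%g = (p ^ n.+1)%N.
  have /p_natP[[|n] ox] := p_x; last by exists n.
  by case/eqP: ntx; apply/eqP; rewrite -order_eq1 ox.
have xq : (x ^+ (p ^ n.+1) = 1)%g by rewrite -ox expg_order.
have Gy : y \in G by rewrite def_y groupX.
have yq : (y ^+ (p ^ n.+1) = 1)%g by rewrite def_y -expgM mulnC expgM xq expg1n.
have chiX i m : i \in B -> coprime m #[x]%g -> 'chi_i (x ^+ m)%g = 'chi_i x.
  by move=> Bi co_m; rewrite char_Crat_expg ?irr_char //; apply: Qx.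
have co_p m : ~~ (p %| m)%N -> coprime m #[x]%g.
  by move=> p'm; rewrite ox coprime_sym coprimeXl // prime_coprime.
have chiy i : i \in B -> 'chi_i y = 'chi_i x by move=> Bi; rewrite def_y chiX.
have chiXV i m : i \in B -> ~~ (p %| m)%N ->
    'chi_i (x ^- m)%g = 'chi_i (x^-1)%g /\ 'chi_i (y ^- m)%g = 'chi_i (y^-1)%g.
  move=> Bi /co_p co_m; rewrite !irr_inv def_y -expgM !chiX //.
  by rewrite coprimeMl co_j.
have [/exists_inP[g Gg /eqP->]|] := boolP [exists g in G, y == (x ^ g)%g]; first by exists g.
rewrite negb_exists_in => /forall_inP not_xGy.
have chi_xy i m : i \in B -> ~~ (p %| m)%N -> 'chi_i (x ^+ m)%g = 'chi_i x.
  by move=> Bi /co_p; apply: chiX.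
have orth : \sum_(i in B) 'chi_i x * 'chi_i (y^-1)%g = 0.
  apply: (block_orthogonality p_pr maxM Mp blockB Gx Gy xq yq) => // i m Bi p'm.
  by rewrite chi_xy //; case: (chiXV i m Bi p'm).
(* The fixed points are [u = z] and [v = 1], so the coefficient in question is that of [f_B] at
   [z]. *)
have : \sum_(i in B) 'chi_i x * 'chi_i (x^-1)%g != 0.
  apply: (block_fixed_nonvanishing p_pr maxM Mp blockB Gx Gx xq xq _ Gz (group1 G)).
  - by move=> i m Bi p'm; rewrite chi_xy //; case: (chiXV i m Bi p'm).
  - exact: (cent1P cxz).
  - by rewrite mulg1 mul1g.
  - by rewrite invg1 mulg1; apply: nz_z.
suff -> : \sum_(i in B) 'chi_i x * 'chi_i (x^-1)%g = 0 by rewrite eqxx.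
(* Values at inverses are complex conjugates, so [chi y = chi x] passes to [y^-1] and [x^-1]. *)
by apply: etrans orth; apply: eq_bigr => i Bi; rewrite !irr_inv chiy.
Qed.
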